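(* Let $p\neq0$ and let $S=\Sigma^2(p)=\{(x,y,z): z=\frac p2-\frac1{2p}(x^2+y^2)\}$ be the sphere of parabolic type in the simply isotropic space $\mathbb{I}^3$ centered at the origin. The relative geodesics of $S$ are obtained by intersecting $S$ with planes passing through its center: every (regular) relative geodesic of $S$ is contained in the intersection of $S$ with a plane through the origin, and the intersection of $S$ with any plane through the origin (isotropic or not) admits a regular parameterization as a relative geodesic.
   Context: The simply isotropic space $\mathbb{I}^3$ is $\mathbb{R}^3$ with the degenerate inner product $u^1v^1+u^2v^2$. A plane is isotropic if it contains a line parallel to the $z$-axis; a smooth surface is admissible if none of its tangent planes is isotropic. For a local parameterization $\mathbf{x}(u^1,u^2)$ of an admissible surface write $\mathbf{x}_i=\partial\mathbf{x}/\partial u^i=(x_i^1,x_i^2,x_i^3)$ and $X_{ij}=x_1^ix_2^j-x_1^jx_2^i$ (so $X_{12}\ne0$). The isotropic Gauss map is $$\xi=\left(\frac{X_{23}}{X_{12}},\ \frac{X_{31}}{X_{12}},\ \frac12\left\{1-\left[\left(\frac{X_{23}}{X_{12}}\right)^2+\left(\frac{X_{31}}{X_{12}}\right)^2\right]\right\}\right).$$ A curve $\gamma:I\to S$ is a relative geodesic ($r$-geodesic) if, for every $t\in I$, the acceleration vector $\gamma''(t)\in\mathbb{R}^3$ is parallel to (a real multiple, possibly zero, of) $\xi$ at $\gamma(t)$. A curve is regular if $\gamma'$ never vanishes. *)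

(* Defs.v *)
From HB Require Import structures.
From mathcomp Require Import all_boot all_order all_algebra.
From mathcomp Require Import all_classical all_reals all_analysis.

Set Implicit Arguments.
Unset Strict Implicit.
Unset Printing Implicit Defensive.

Import Order.TTheory GRing.Theory Num.Theory.
Import numFieldNormedType.Exports.

Local Open Scope classical_set_scope.
Local Open Scope ring_scope.

(* Points and vectors of R^3 are row vectors; the coordinates (x, y, z), or
   upper indices (1, 2, 3), are the entries of index 0, 1, 2. *)

Definition vec3 (R : realType) (a b c : R) : 'rV[R]_3 :=
  \row_(i < 3) [:: a; b; c]`_i.

(* C^k on an open set U, the values of f outside U being irrelevant. All
   directional derivatives are used instead of a basis, so that the same
   definition serves for curves (V = R) and for surfaces (V = R^2). *)
Fixpoint Ck (R : realType) (V W : normedModType R) (U : set V) (k : nat)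
    (f : V -> W) {struct k} : Prop :=
  (forall a, U a -> {for a, continuous f}) /\
  match k with
  | 0%N => True
  | k'.+1 => (forall a v, U a -> derivable f a v) /\
             (forall v, Ck U k' (fun a => 'D_v f a))
  end.

Definition smooth_on (R : realType) (V W : normedModType R) (U : set V)
    (f : V -> W) : Prop :=
  forall k : nat, Ck U k f.

Definition partial (R : realType) (x : 'rV[R]_2 -> 'rV[R]_3) (i : 'I_2)
    (u : 'rV[R]_2) : 'rV[R]_3 :=
  'D_(delta_mx 0 i) x u.

(* X_ij = x_1^i x_2^j - x_1^j x_2^i, with all indices shifted down by one *)
Definition minorX (R : realType) (x : 'rV[R]_2 -> 'rV[R]_3) (u : 'rV[R]_2)
    (i j : 'I_3) : R :=
  partial x 0 u 0 i * partial x 1 u 0 j - partial x 0 u 0 j * partial x 1 u 0 i.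

Definition iso_gauss (R : realType) (x : 'rV[R]_2 -> 'rV[R]_3)
    (u : 'rV[R]_2) : 'rV[R]_3 :=
  let a := minorX x u 1 2 / minorX x u 0 1 in
  let b := minorX x u 2 0 / minorX x u 0 1 in
  vec3 a b (2^-1 * (1 - (a ^+ 2 + b ^+ 2))).

(* The row space of this matrix is the direction of the tangent plane. *)
Definition tangent_mx (R : realType) (x : 'rV[R]_2 -> 'rV[R]_3)
    (u : 'rV[R]_2) : 'M[R]_(2, 3) :=
  \matrix_(i < 2) partial x i u.

(* A plane contains a line parallel to the z-axis iff (0, 0, 1) belongs to its
   direction. *)
Definition isotropic_direction (R : realType) (k : nat) (T : 'M[R]_(k, 3)) :
    bool :=
  (vec3 0 0 1 <= T)%MS.

(* Local parameterizations of an admissible surface: smooth immersions that are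
   homeomorphisms from an open U onto a relatively open part of S (this is the
   injectivity together with the last clause), with non-isotropic tangent
   planes. *)
Definition admissible_param (R : realType) (S : set 'rV[R]_3)
    (U : set 'rV[R]_2) (x : 'rV[R]_2 -> 'rV[R]_3) : Prop :=
  [/\ open U,
      smooth_on U x,
      forall u, U u ->
        row_free (tangent_mx x u) /\ ~~ isotropic_direction (tangent_mx x u),
      {in U &, injective x} &
      forall V : set 'rV[R]_2, open V -> V `<=` U ->
        exists W : set 'rV[R]_3, open W /\ x @` V = S `&` W].

(* The isotropic Gauss map of S at q, as a relation: its value does not depend
   on the parameterization, since the X_ij are all multiplied by the same
   Jacobian determinant under a change of coordinates. *)
Definition gauss_at (R : realType) (S : set 'rV[R]_3)
    (q xi : 'rV[R]_3) : Prop :=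
  exists (U : set 'rV[R]_2) (x : 'rV[R]_2 -> 'rV[R]_3) (u : 'rV[R]_2),
    [/\ admissible_param S U x, U u, x u = q & xi = iso_gauss x u].

(* Curves I -> S on an open interval I (possibly unbounded) are total functions
   restricted to I; r-geodesics are only asked to be twice differentiable. *)
Definition r_geodesic (R : realType) (S : set 'rV[R]_3) (I : set R)
    (g : R -> 'rV[R]_3) : Prop :=
  [/\ open I, is_interval I,
      forall t, I t -> S (g t),
      forall t, I t -> derivable g t 1 /\ derivable (derive1 g) t 1 &
      forall t, I t -> exists (xi : 'rV[R]_3) (k : R),
        gauss_at S (g t) xi /\ derive1n 2 g t = k *: xi].

Definition regular_on (R : realType) (I : set R) (g : R -> 'rV[R]_3) : Prop :=
  forall t, I t -> derive1 g t != 0.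

Definition parabolic_sphere (R : realType) (p : R) : set 'rV[R]_3 :=
  [set q | q 0 2 = p / 2 - (2 * p)^-1 * (q 0 0 ^+ 2 + q 0 1 ^+ 2)].

(* The plane through c with Euclidean normal n; it is a plane when n != 0, and
   it is isotropic exactly when n 0 2 = 0. *)
Definition plane_through (R : realType) (c n : 'rV[R]_3) : set 'rV[R]_3 :=
  [set q | \sum_(i < 3) n 0 i * (q 0 i - c 0 i) = 0].

(* Main.v *)
Require Import Defs.
From HB Require Import structures.
From mathcomp Require Import all_boot all_order all_algebra.
From mathcomp Require Import all_classical all_reals all_analysis.
From mathcomp Require Import ring lra.

Set Implicit Arguments.
Unset Strict Implicit.
Unset Printing Implicit Defensive.

Import Order.TTheory GRing.Theory Num.Theory.
Import numFieldNormedType.Exports.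
Local Open Scope classical_set_scope.
Local Open Scope ring_scope.

(** On the sphere [z = p / 2 - (x ^ 2 + y ^ 2) / (2 p)] the isotropic Gauss map
    at a point [q] is the multiple [q / p] of the position vector,
    whatever the parameterization ([gauss_at_sphere]). Relative geodesics are
    therefore the curves of the sphere whose acceleration points along the
    position vector: motions in a central field, with no condition on the
    strength of the field.

    Such a motion conserves the angular momentum [g x g'], which is orthogonal
    to [g] and hence a normal vector of a plane through the origin that
    contains the curve. It does not vanish: that would make the velocity
    radial, and a tangent plane of the sphere never contains the radial
    direction, so that the velocity would be zero ([velocity_eq0]).

    Conversely, a curve in a plane through the origin is a motion in a central
    field as soon as it sweeps area about the origin at a constant rate. A
    section of the sphere by such a plane is a parabola (isotropic plane) or an
    ellipse seen from above as a circle. Let [h] parameterize it, let [F] be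
    proportional to the area swept by [h], and reparameterize by the inverse of
    [F] ([area_law_geodesic]). The function [F] is a cubic polynomial for the
    parabola, and a variant of Kepler's equation for the ellipse. In both
    cases the derivative of [F] is bounded below by a positive constant, so
    [F] is a bijection of the line and the geodesic runs through the whole
    section. *)

(** * Smoothness by stability under differentiation *)

(** Smoothness is proved coinductively: all the functions of a set that is
    stable under directional derivatives are smooth. *)
Definition derivation_stable (R : realType) (V : normedModType R)
    (C : set (V -> R)) : Prop :=
  forall f, C f ->
    (forall a, differentiable f a) /\ forall v, C (fun a => 'D_v f a).

Lemma differentiable_row (R : realType) (V : normedModType R) (n : nat)
    (f : V -> 'rV[R]_n) (a : V) :
  (forall i, differentiable (fun u => f u 0 i) a) -> differentiable f a.
Proof.
move=> df.
have -> : f = \sum_(i < n) (fun u => f u 0 i *: (delta_mx 0 i : 'rV[R]_n)).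
  by apply/funext => u; rewrite fct_sumE [LHS]row_sum_delta.
by apply: differentiable_sum => i; exact: differentiableZl.
Qed.

Lemma derive_row (R : realType) (V : normedModType R) (n : nat)
    (f : V -> 'rV[R]_n) (a v : V) (i : 'I_n) :
  derivable f a v -> 'D_v f a 0 i = 'D_v (fun u => f u 0 i) a.
Proof. by move=> df; rewrite derive_mx// mxE. Qed.

Lemma smooth_on_row (R : realType) (V : normedModType R) (n : nat)
    (C : set (V -> R)) (f : V -> 'rV[R]_n) :
  derivation_stable C -> (forall i, C (fun u => f u 0 i)) ->
  smooth_on setT f.
Proof.
move=> stC + k; elim: k f => [|k IH] f Cf;
  have df a : differentiable f a
    by apply: differentiable_row => i; have [] := stC _ (Cf i).
  by split=> // a _; exact: differentiable_continuous.
split=> [a _|]; first exact: differentiable_continuous.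
split=> [a v _|v]; first exact: diff_derivable.
apply: IH => i; have [_ /(_ v)] := stC _ (Cf i).
congr C; apply/funext => a; rewrite derive_row//; exact: diff_derivable.
Qed.

(** Stability is easily checked on a set of the form [generated B], as the sum,
    product and inverse rules reduce it to the functions of [B]. *)
Inductive generated (R : realType) (V : normedModType R) (B : set (V -> R)) :
    set (V -> R) :=
| gen_base f : B f -> generated B f
| gen_cst (c : R) : generated B (fun=> c)
| gen_add f g : generated B f -> generated B g ->
    generated B (fun a => f a + g a)
| gen_mul f g : generated B f -> generated B g ->
    generated B (fun a => f a * g a)
| gen_inv f : generated B f -> (forall a, f a != 0) ->
    generated B (fun a => (f a)^-1).

Lemma gen_opp (R : realType) (V : normedModType R) (B : set (V -> R)) f :
  generated B f -> generated B (fun a => - f a).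
Proof.
move=> gf; rewrite (_ : (fun _ => _) = fun a => -1 * f a).
  by apply: gen_mul => //; exact: gen_cst.
by apply/funext => a; rewrite mulN1r.
Qed.

Lemma generated_stable (R : realType) (V : normedModType R) (B : set (V -> R)) :
  (forall b, B b ->
    (forall a, differentiable b a) /\
    forall v, generated B (fun a => 'D_v b a)) ->
  derivation_stable (generated B).
Proof.
move=> stB f; elim=> {f} [f /stB //|c|f g gf [df Df] gg [dg Dg]
  |f g gf [df Df] gg [dg Dg]|f gf [df Df] f0].
- split=> [a|v]; first exact: differentiable_cst.
  rewrite (_ : (fun _ => _) = fun=> (0 : R)); first exact: gen_cst.
  by apply/funext => a; rewrite (derive_cst (c : R^o)).
- split=> [a|v]; first exact: differentiableD.
  rewrite (_ : (fun _ => _) = fun a => 'D_v f a + 'D_v g a).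
    exact: gen_add.
  by apply/funext => a; apply: deriveD; exact: diff_derivable.
- split=> [a|v]; first exact: differentiableM.
  rewrite (_ : (fun _ => _) = fun a => f a * 'D_v g a + g a * 'D_v f a).
    by apply: gen_add; apply: gen_mul.
  by apply/funext => a; apply: deriveM; exact: diff_derivable.
- split=> [a|v]; first exact: differentiableV.
  rewrite (_ : (fun _ => _) = fun a => - ((f a)^-1 * (f a)^-1) * 'D_v f a).
    apply: gen_mul => //; apply: gen_opp; apply: gen_mul; exact: gen_inv.
  apply/funext => a; rewrite deriveV//; last exact: diff_derivable.
  by rewrite expr2 invfM.
Qed.

Lemma derive_line (R : realType) (f : R -> R) (a v : R) :
  derivable f a 1 -> 'D_v f a = v * derive1 f a.
Proof.
by move=> df; rewrite deriveE ?deriv1E//; exact/derivable1_diffP.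
Qed.

(** From these functions the parameterizations of the plane sections are built,
    and the rates at which these parameterizations sweep area. *)
Definition trig_base (R : realType) : set (R -> R) :=
  [set f | [\/ f = id, f = @sin R | f = @cos R]].

Definition trig (R : realType) : set (R -> R) := generated (@trig_base R).

Lemma trig_id (R : realType) : @trig R id.
Proof. by apply: gen_base; apply: Or31. Qed.

Lemma trig_sin (R : realType) : @trig R (@sin R).
Proof. by apply: gen_base; apply: Or32. Qed.

Lemma trig_cos (R : realType) : @trig R (@cos R).
Proof. by apply: gen_base; apply: Or33. Qed.

Lemma trig_stable (R : realType) : derivation_stable (@trig R).
Proof.
apply: generated_stable => _ [] ->; split=> [a|v].
- exact/derivable1_diffP.
- rewrite (_ : (fun _ => _) = fun=> v); first exact: gen_cst.
  by apply/funext => a; exact: derive_id.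
- exact/derivable1_diffP.
- rewrite (_ : (fun _ => _) = fun a => v * cos a).
    by apply: gen_mul; [exact: gen_cst|exact: trig_cos].
  by apply/funext => a; rewrite derive_line// derive1E derive_val.
- exact/derivable1_diffP.
- rewrite (_ : (fun _ => _) = fun a => v * - sin a).
    by apply: gen_mul; [exact: gen_cst|apply: gen_opp; exact: trig_sin].
  by apply/funext => a; rewrite derive_line// derive1E derive_val.
Qed.

Lemma trig_derive1 (R : realType) (f : R -> R) : trig f -> trig (derive1 f).
Proof.
move=> /trig_stable[_ /(_ 1)]; congr (trig _).
by apply/funext => a; rewrite derive1E.
Qed.
Lemma trig_derivable (R : realType) (f : R -> R) (s : R) :
  @trig R f -> derivable f s 1.
Proof. by move=> /trig_stable[df _]; exact: diff_derivable. Qed.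

(** * The isotropic Gauss map of the sphere *)

Lemma ord3P (P : 'I_3 -> Prop) : P 0 -> P 1 -> P 2 -> forall i, P i.
Proof.
move=> P0 P1 P2 [[|[|[|//]]] lti].
- by rewrite (_ : Ordinal lti = 0)//; exact: val_inj.
- by rewrite (_ : Ordinal lti = 1)//; exact: val_inj.
- by rewrite (_ : Ordinal lti = 2)//; exact: val_inj.
Qed.

Lemma row2P (R : realType) (u w : 'rV[R]_2) :
  u 0 0 = w 0 0 -> u 0 1 = w 0 1 -> u = w.
Proof.
move=> u0 u1; apply/rowP => -[[|[|//]] lti].
- by rewrite (_ : Ordinal lti = 0)//; exact: val_inj.
- by rewrite (_ : Ordinal lti = 1)//; exact: val_inj.
Qed.

Lemma vec3E (R : realType) (a b c : R) :
  (vec3 a b c 0 0 = a) * (vec3 a b c 0 1 = b) * (vec3 a b c 0 2 = c).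
Proof. by rewrite !mxE. Qed.

Lemma mul_tangent_mx (R : realType) (x : 'rV[R]_2 -> 'rV[R]_3)
    (u d : 'rV[R]_2) (k : 'I_3) :
  (d *m tangent_mx x u) 0 k =
    d 0 0 * partial x 0 u 0 k + d 0 1 * partial x 1 u 0 k.
Proof.
have sum2 (F : 'I_2 -> R) : \sum_i F i = F 0 + F 1.
  by rewrite !big_ord_recl big_ord0 addr0; congr (_ + F _); exact: val_inj.
by rewrite mxE sum2 !mxE.
Qed.

Lemma partial_coord (R : realType) (x : 'rV[R]_2 -> 'rV[R]_3) (u : 'rV[R]_2)
    (i : 'I_2) (k : 'I_3) :
  derivable x u (delta_mx 0 i) ->
  is_derive u (delta_mx 0 i) (fun w => x w 0 k) (partial x i u 0 k).
Proof.
move=> dx; apply: DeriveDef; first by move/derivable_mxP : dx; exact.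
by rewrite /partial derive_row.
Qed.

Lemma is_derive_height (R : realType) (V : normedModType R) (p : R)
    (f g : V -> R) (a v : V) (df dg : R) :
  p != 0 -> is_derive a v f df -> is_derive a v g dg ->
  is_derive a v (fun w => p / 2 - (2 * p)^-1 * (f w ^+ 2 + g w ^+ 2))
    (- (f a * df + g a * dg) / p).
Proof.
move=> p0 Hf Hg.
have -> : (fun w => p / 2 - (2 * p)^-1 * (f w ^+ 2 + g w ^+ 2)) =
    cst (p / 2) - (cst (2 * p)^-1 * (f * f + g * g)).
  by apply/funext => w; rewrite !fctE !expr2.
apply: (is_derive_eq (is_deriveB (is_derive_cst _ _ _)
  (is_deriveM (is_derive_cst _ _ _)
    (is_deriveD (is_deriveM Hf Hf) (is_deriveM Hg Hg))))).
by rewrite !fctE /GRing.scale/=; field.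
Qed.

(** The parameterization takes its values in the sphere on the open set [U], so
    the equation of the sphere may be differentiated. *)
Lemma partial_height (R : realType) (p : R) (U : set 'rV[R]_2)
    (x : 'rV[R]_2 -> 'rV[R]_3) (u : 'rV[R]_2) (i : 'I_2) :
  p != 0 -> admissible_param (parabolic_sphere p) U x -> U u ->
  partial x i u 0 2 =
    - (x u 0 0 * partial x i u 0 0 + x u 0 1 * partial x i u 0 1) / p.
Proof.
move=> p0 [oU smx _ _ img] Uu.
have [_ [dx _]] := smx 1%N.
have Dx k := partial_coord k (dx u (delta_mx 0 i) Uu).
have [W [_ UW]] := img U oU (@subset_refl _ U).
have xS w : U w -> parabolic_sphere p (x w).
  by move=> Uw; have : (x @` U) (x w) by [exists w]; rewrite UW => -[].
have D2 := is_derive_height p0 (Dx 0) (Dx 1).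
rewrite -(@derive_val _ _ _ _ _ _ _ D2) -(@derive_val _ _ _ _ _ _ _ (Dx 2)).
apply: near_eq_derive; near=> w; apply: xS; near: w.
exact: open_nbhs_nbhs.
Unshelve. all: by end_near. Qed.

(** For two vectors [a], [b] tangent to the sphere above the point [(X, Y)]: the
    third coordinates are linear functions of the first two, so linear
    independence survives the projection to the horizontal plane. *)
Lemma tangent_minor_neq0 (R : realType) (p X Y a0 a1 a2 b0 b1 b2 : R) :
  p != 0 -> a2 = - (X * a0 + Y * a1) / p -> b2 = - (X * b0 + Y * b1) / p ->
  (forall s t, s * a0 + t * b0 = 0 -> s * a1 + t * b1 = 0 ->
    s * a2 + t * b2 = 0 -> s = 0 /\ t = 0) ->
  a0 * b1 - a1 * b0 != 0.
Proof.
move=> p0 a2E b2E free; apply/eqP => J0.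
have free2 s t : s * a0 + t * b0 = 0 -> s * a1 + t * b1 = 0 -> s = 0 /\ t = 0.
  move=> E0 E1; apply: free => //; rewrite a2E b2E.
  transitivity (- (X * (s * a0 + t * b0) + Y * (s * a1 + t * b1)) / p).
    by ring.
  by rewrite E0 E1; ring.
have [||b00 a00] := free2 b0 (- a0); first by ring.
  by rewrite -[RHS]oppr0 -J0; ring.
have [||b10 a10] := free2 b1 (- a1); first by rewrite -[RHS]J0; ring.
  by ring.
have [||/eqP] := free2 1 0; last by rewrite oner_eq0.
- by rewrite -[a0]opprK a00; ring.
- by rewrite -[a1]opprK a10; ring.
Qed.

Lemma minor_neq0 (R : realType) (p : R) (U : set 'rV[R]_2)
    (x : 'rV[R]_2 -> 'rV[R]_3) (u : 'rV[R]_2) :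
  p != 0 -> admissible_param (parabolic_sphere p) U x -> U u ->
  minorX x u 0 1 != 0.
Proof.
move=> p0 admx Uu; have [_ _ /(_ u Uu)[free_x _] _ _] := admx.
apply: (tangent_minor_neq0 p0 (partial_height 0 p0 admx Uu)
  (partial_height 1 p0 admx Uu)) => s t E0 E1 E2.
pose d : 'rV[R]_2 := \row_(i < 2) [:: s; t]`_i.
have [d0 d1] : d 0 0 = s /\ d 0 1 = t by rewrite !mxE.
have : d *m tangent_mx x u == 0.
  by apply/eqP/rowP; apply: ord3P; rewrite mul_tangent_mx d0 d1 [RHS]mxE.
by rewrite mulmx_free_eq0// => /eqP dz; rewrite -d0 -d1 dz !mxE.
Qed.

(** Cramer's rule: these ratios are the coefficients, up to sign, of the third
    coordinate of a tangent vector as a linear form in the first two. *)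
Lemma tangent_minor_ratios (R : realType) (p X Y a0 a1 a2 b0 b1 b2 : R) :
  p != 0 -> a2 = - (X * a0 + Y * a1) / p -> b2 = - (X * b0 + Y * b1) / p ->
  a0 * b1 - a1 * b0 != 0 ->
  (a1 * b2 - a2 * b1) / (a0 * b1 - a1 * b0) = p^-1 * X /\
  (a2 * b0 - a0 * b2) / (a0 * b1 - a1 * b0) = p^-1 * Y.
Proof.
move=> p0 -> -> J0; split; apply: (canLR (mulfK J0)); field; exact: p0.
Qed.

(** The two ratios of minors are [x / p] and [y / p]; the third coordinate of
    the Gauss map is then [z / p] by the equation of the sphere. *)
Lemma iso_gauss_sphere (R : realType) (p : R) (U : set 'rV[R]_2)
    (x : 'rV[R]_2 -> 'rV[R]_3) (u : 'rV[R]_2) :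
  p != 0 -> admissible_param (parabolic_sphere p) U x -> U u ->
  parabolic_sphere p (x u) -> iso_gauss x u = p^-1 *: x u.
Proof.
move=> p0 admx Uu xS.
have [a1 a2] := tangent_minor_ratios p0 (partial_height 0 p0 admx Uu)
  (partial_height 1 p0 admx Uu) (minor_neq0 p0 admx Uu).
have -> : iso_gauss x u = vec3 (p^-1 * x u 0 0) (p^-1 * x u 0 1)
    (2^-1 * (1 - ((p^-1 * x u 0 0) ^+ 2 + (p^-1 * x u 0 1) ^+ 2))).
  by rewrite -a1 -a2.
apply/rowP; apply: ord3P; rewrite !mxE//= xS.
by field.
Qed.

(** A single chart for the whole sphere: through it the Gauss map is defined at
    every point. *)
Definition monge (R : realType) (p : R) (u : 'rV[R]_2) : 'rV[R]_3 :=
  vec3 (u 0 0) (u 0 1) (p / 2 - (2 * p)^-1 * (u 0 0 ^+ 2 + u 0 1 ^+ 2)).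

Lemma is_derive_coord (R : realType) (n : nat) (u v : 'rV[R]_n) (i : 'I_n) :
  is_derive u v (fun w : 'rV[R]_n => w 0 i) (v 0 i).
Proof.
apply: DeriveDef; first exact/diff_derivable/differentiable_coord.
by rewrite -(derive_row (f := id))// derive_id.
Qed.

Lemma monge_smooth (R : realType) (p : R) : smooth_on setT (monge p).
Proof.
pose B : set ('rV[R]_2 -> R) :=
  [set f | exists i : 'I_2, f = fun w : 'rV[R]_2 => w 0 i].
have stB : derivation_stable (generated B).
  apply: generated_stable => _ [i ->]; split=> [a|v].
    exact: differentiable_coord.
  rewrite (_ : (fun _ => _) = fun=> v 0 i); first exact: gen_cst.
  by apply/funext => a; have D := is_derive_coord a v i; rewrite derive_val.
have gB i : generated B (fun w : 'rV[R]_2 => w 0 i).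
  by apply: gen_base; exists i.
apply: (smooth_on_row stB); apply: ord3P.
- rewrite (_ : (fun _ => _) = fun w : 'rV[R]_2 => w 0 0)//.
  by apply/funext => w; rewrite mxE.
- rewrite (_ : (fun _ => _) = fun w : 'rV[R]_2 => w 0 1)//.
  by apply/funext => w; rewrite mxE.
- rewrite (_ : (fun _ => _) = fun w : 'rV[R]_2 =>
      p / 2 + (- (2 * p)^-1) * (w 0 0 * w 0 0 + w 0 1 * w 0 1)).
    apply: gen_add; first exact: gen_cst.
    apply: gen_mul; first exact: gen_cst.
    by apply: gen_add; apply: gen_mul.
  by apply/funext => w; rewrite mxE/= !expr2 mulNr.
Qed.

Lemma partial_monge (R : realType) (p : R) (u : 'rV[R]_2) (i : 'I_2) :
  (partial (monge p) i u 0 0 = (0 == i)%:R) *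
  (partial (monge p) i u 0 1 = (1 == i)%:R).
Proof.
have dm : derivable (monge p) u (delta_mx 0 i).
  by have [_ [dm _]] := monge_smooth p 1%N; exact: dm.
split; rewrite /partial derive_row//.
- rewrite (_ : (fun _ => _) = fun w : 'rV[R]_2 => w 0 0); last first.
    by apply/funext => w; rewrite mxE.
  have D := is_derive_coord u (delta_mx 0 i) 0.
  by rewrite derive_val mxE.
- rewrite (_ : (fun _ => _) = fun w : 'rV[R]_2 => w 0 1); last first.
    by apply/funext => w; rewrite mxE.
  have D := is_derive_coord u (delta_mx 0 i) 1.
  by rewrite derive_val mxE.
Qed.

Definition top_view (R : realType) (q : 'rV[R]_3) : 'rV[R]_2 :=
  \row_(j < 2) [:: q 0 0; q 0 1]`_j.

Lemma mongeK (R : realType) (p : R) : cancel (monge p) (@top_view R).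
Proof. by move=> u; apply: row2P; rewrite !mxE. Qed.

Lemma top_viewK (R : realType) (p : R) (q : 'rV[R]_3) :
  parabolic_sphere p q -> monge p (top_view q) = q.
Proof. by move=> Sq; apply/rowP; apply: ord3P; rewrite !mxE//= Sq. Qed.

Lemma monge_sphere (R : realType) (p : R) (u : 'rV[R]_2) :
  parabolic_sphere p (monge p u).
Proof. by rewrite /parabolic_sphere/= !mxE. Qed.

Lemma top_view_continuous (R : realType) : continuous (@top_view R).
Proof.
move=> q; apply: differentiable_continuous; apply: differentiable_row => i.
have [k ->] : exists k, (fun w : 'rV[R]_3 => top_view w 0 i) = fun w => w 0 k.
  by case: i => [[|[|//]] lti]; [exists 0|exists 1];
    apply/funext => w; rewrite mxE.
exact: differentiable_coord.
Qed.

Lemma mul_tangent_monge (R : realType) (p : R) (u d : 'rV[R]_2) :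
  ((d *m tangent_mx (monge p) u) 0 0 = d 0 0) *
  ((d *m tangent_mx (monge p) u) 0 1 = d 0 1).
Proof.
have P i := partial_monge p u i.
split; rewrite mul_tangent_mx.
- transitivity (d 0 0 * (0 == 0 :> 'I_2)%:R + d 0 1 * (0 == 1 :> 'I_2)%:R).
    by congr (_ * _ + _ * _); [exact: (P 0).1|exact: (P 1).1].
  by rewrite mulr1 mulr0 addr0.
- transitivity (d 0 0 * (1 == 0 :> 'I_2)%:R + d 0 1 * (1 == 1 :> 'I_2)%:R).
    by congr (_ * _ + _ * _); [exact: (P 0).2|exact: (P 1).2].
  by rewrite mulr1 mulr0 add0r.
Qed.

Lemma monge_admissible (R : realType) (p : R) :
  admissible_param (parabolic_sphere p) setT (monge p).
Proof.
split; [exact: openT|exact: monge_smooth| | |].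
- move=> u _; split.
    apply: inj_row_free => d dT0; apply: row2P.
      by rewrite -(mul_tangent_monge p u d).1 dT0 !mxE.
    by rewrite -(mul_tangent_monge p u d).2 dT0 !mxE.
  apply/negP => /submxP[d dT].
  have d0 : d = 0.
    apply: row2P; first by rewrite -(mul_tangent_monge p u d).1 -dT !mxE.
    by rewrite -(mul_tangent_monge p u d).2 -dT !mxE.
  move: dT; rewrite d0 mul0mx => /rowP/(_ 2) /eqP.
  by rewrite !mxE/= oner_eq0.
- by move=> u w _ _; exact: (can_inj (@mongeK _ p)).
- move=> V oV _; exists (@top_view R @^-1` V); split.
    by apply: open_comp => // q _; exact: top_view_continuous.
  apply/seteqP; split=> [_ [u Vu <-]|q [Sq Vq]].
    by split; [exact: monge_sphere|rewrite /= mongeK].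
  by exists (top_view q) => //; exact: top_viewK.
Qed.

Lemma gauss_at_sphere (R : realType) (p : R) (q xi : 'rV[R]_3) :
  p != 0 -> parabolic_sphere p q ->
  gauss_at (parabolic_sphere p) q xi <-> xi = p^-1 *: q.
Proof.
move=> p0 Sq; split=> [[U [x [u [admx Uu xu ->]]]]|->].
  by rewrite (iso_gauss_sphere p0 admx Uu) xu.
exists setT, (monge p), (top_view q); split=> //.
- exact: monge_admissible.
- exact: top_viewK.
- by rewrite (iso_gauss_sphere p0 (monge_admissible p))// top_viewK.
Qed.

(** * Geodesics lie in planes through the centre *)

Lemma constant_on_interval (R : realType) (I : set R) (f : R -> R) :
  is_interval I -> (forall t, I t -> is_derive t 1 f 0) ->
  forall s t, I s -> I t -> f s = f t.
Proof.
move=> itvI df s t; wlog st : s t / s <= t => [th Is It|Is It].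
  by have [/th|/ltW/th] := leP s t => ->.
have seg c : c \in `[s, t] -> I c.
  by rewrite in_itv/= => cst; exact: itvI Is It _ cst.
have [c c_st||c _ E] := @MVT_segment _ f (cst 0) s t st.
- by apply: df; apply: seg; move: c_st; exact: subset_itv_oo_cc.
- by apply: derivable_within_continuous => c /seg/df Df; exact: ex_derive.
- by apply/esym/eqP; rewrite -subr_eq0 E /= mul0r.
Qed.

Lemma is_derive_curve (R : realType) (n : nat) (g : R -> 'rV[R]_n) (t : R)
    (i : 'I_n) :
  derivable g t 1 -> is_derive t 1 (fun s => g s 0 i) (derive1 g t 0 i).
Proof.
move=> dg; apply: DeriveDef; first by move/derivable_mxP : dg; exact.
by rewrite derive1E derive_row.
Qed.

(** A central acceleration preserves the angular momentum: in the derivative of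
    a coordinate of [g x g'] the terms in [g' x g'] cancel, and those in
    [g x g''] cancel because [g'' = k g]. *)
Lemma is_derive_wedge (R : realType) (n : nat) (g : R -> 'rV[R]_n) (t k : R)
    (i j : 'I_n) :
  derivable g t 1 -> derivable (derive1 g) t 1 -> derive1n 2 g t = k *: g t ->
  is_derive t 1 (fun s => g s 0 i * derive1 g s 0 j - g s 0 j * derive1 g s 0 i)
    0.
Proof.
move=> dg ddg acc.
have D l := is_derive_curve l dg; have DD l := is_derive_curve l ddg.
have accl l : derive1 (derive1 g) t 0 l = k * g t 0 l.
  by rewrite -[derive1 (derive1 g)]/(derive1n 2 g) acc mxE.
apply: (is_derive_eq (is_deriveB (is_deriveM (D i) (DD j))
  (is_deriveM (D j) (DD i)))).
by rewrite !accl /GRing.scale/=; ring.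
Qed.

(** With coefficients [2 p] and [- 2 y], the last two coordinates of the angular
    momentum combine to [(p ^ 2 + x ^ 2 + y ^ 2) x'], since
    [2 p z + x ^ 2 + y ^ 2 = p ^ 2] on the sphere; similarly for [y']. *)
Lemma velocity_eq0 (R : realType) (p x y z x' y' z' : R) :
  p != 0 -> z = p / 2 - (2 * p)^-1 * (x ^+ 2 + y ^+ 2) ->
  z' = - (x * x' + y * y') / p ->
  y * z' - z * y' = 0 -> z * x' - x * z' = 0 ->
  x * y' - y * x' = 0 -> [/\ x' = 0, y' = 0 & z' = 0].
Proof.
move=> p0 zE z'E c0 c1 c2.
have h0 : p ^+ 2 + (x ^+ 2 + y ^+ 2) != 0.
  by rewrite gt_eqF// ltr_pwDl ?addr_ge0 ?sqr_ge0// exprn_even_gt0.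
have x'0 : x' = 0.
  apply: (mulfI h0); rewrite mulr0.
  transitivity (2 * p * (z * x' - x * z') - 2 * y * (x * y' - y * x')).
    by rewrite zE z'E; field.
  by rewrite c1 c2; ring.
have y'0 : y' = 0.
  apply: (mulfI h0); rewrite mulr0.
  transitivity (- 2 * p * (y * z' - z * y') + 2 * x * (x * y' - y * x')).
    by rewrite zE z'E; field.
  by rewrite c0 c2; ring.
by split=> //; rewrite z'E x'0 y'0; ring.
Qed.

Lemma sphere_velocity (R : realType) (p : R) (I : set R) (g : R -> 'rV[R]_3)
    (t : R) :
  p != 0 -> open I -> (forall s, I s -> parabolic_sphere p (g s)) -> I t ->
  derivable g t 1 ->
  derive1 g t 0 2 =
    - (g t 0 0 * derive1 g t 0 0 + g t 0 1 * derive1 g t 0 1) / p.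
Proof.
move=> p0 oI gS It dg; have D l := is_derive_curve l dg.
have D2 := is_derive_height p0 (D 0) (D 1).
rewrite -(@derive_val _ _ _ _ _ _ _ D2) -(@derive_val _ _ _ _ _ _ _ (D 2)).
apply: near_eq_derive; near=> w; apply: gS; near: w.
exact: open_nbhs_nbhs.
Unshelve. all: by end_near. Qed.

Lemma plane_through0 (R : realType) (n q : 'rV[R]_3) :
  plane_through 0 n q <->
  n 0 0 * q 0 0 + n 0 1 * q 0 1 + n 0 2 * q 0 2 = 0.
Proof.
rewrite /plane_through/=.
have -> : \sum_(i < 3) n 0 i * (q 0 i - (0 : 'rV[R]_3) 0 i) =
    n 0 0 * q 0 0 + n 0 1 * q 0 1 + n 0 2 * q 0 2.
  rewrite !big_ord_recl big_ord0 !mxE !subr0 addr0 addrA.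
  by congr (_ + _ * _ + _ * _); congr (_ _ _); exact: val_inj.
by [].
Qed.

Lemma geodesic_in_plane (R : realType) (p : R) (I : set R) (g : R -> 'rV[R]_3) :
  p != 0 -> r_geodesic (parabolic_sphere p) I g -> regular_on I g ->
  exists2 n : 'rV[R]_3, n != 0 &
    g @` I `<=` parabolic_sphere p `&` plane_through 0 n.
Proof.
move=> p0 [oI itvI gS dg acc] reg.
(* On an empty interval any plane will do. *)
have [->|/set0P[t0 It0]] := eqVneq I set0.
  exists (vec3 1 0 0); last by move=> _ [t []].
  by apply/eqP => /rowP/(_ 0)/eqP; rewrite !mxE oner_eq0.
pose w i j t := g t 0 i * derive1 g t 0 j - g t 0 j * derive1 g t 0 i.
have w_cst i j t : I t -> w i j t = w i j t0.
  move=> It; apply: (constant_on_interval itvI _ It It0) => s Is.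
  have [dgs ddgs] := dg s Is; have [xi [k [gauss acc_s]]] := acc s Is.
  apply: (is_derive_wedge (k := k * p^-1)) => //.
  by rewrite acc_s (proj1 (gauss_at_sphere xi p0 (gS s Is)) gauss) scalerA.
exists (vec3 (w 1 2 t0) (w 2 0 t0) (w 0 1 t0)).
  apply: contra (reg t0 It0) => /eqP n0; apply/eqP.
  have [//|||e0 e1 e2] := velocity_eq0 p0 (gS t0 It0)
    (sphere_velocity p0 oI gS It0 (dg t0 It0).1).
  - by have /rowP/(_ 0) := n0; rewrite !mxE.
  - by have /rowP/(_ 1) := n0; rewrite !mxE.
  - by have /rowP/(_ 2) := n0; rewrite !mxE.
  by apply/rowP; apply: ord3P; rewrite mxE.
move=> _ [t It <-]; split; first exact: gS.
by apply/plane_through0; rewrite !vec3E -!(w_cst _ _ t It) /w; ring.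
Qed.

(** * Reparameterization by the swept area *)

Lemma is_derive_row (R : realType) (V : normedModType R) (n : nat)
    (f : V -> 'rV[R]_n) (a v : V) (l : 'rV[R]_n) :
  (forall i, is_derive a v (fun u => f u 0 i) (l 0 i)) -> is_derive a v f l.
Proof.
move=> Df.
have df : derivable f a v by apply/derivable_mxP => i j; rewrite (ord1 i).
apply: DeriveDef => //; apply/rowP => i.
by rewrite derive_row//; exact: derive_val.
Qed.

Lemma is_derive_chain (R : realType) (W : normedModType R) (f : R -> W)
    (G : R -> R) (t dG : R) (df : W) :
  is_derive (G t) 1 f df -> is_derive t 1 G dG ->
  is_derive t 1 (fun s => f (G s)) (dG *: df).
Proof.
move=> [f1 <-] [G1 <-].
have f1' : differentiable f (G t) by exact/derivable1_diffP.
have G1' : differentiable G t by exact/derivable1_diffP.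
apply: DeriveDef; first exact/derivable1_diffP/differentiable_comp.
rewrite (deriveE _ (differentiable_comp G1' f1')) diff_comp//=.
by rewrite -(deriveE _ G1') deriv1E// derive1E.
Qed.

(** By the mean value theorem [F] grows at least as fast as [m s], which gives
    injectivity, and values on both sides of any number. *)
Lemma growth_bijective (R : realType) (F F1 : R -> R) (m : R) :
  0 < m -> (forall s : R, is_derive s 1 F (F1 s)) -> (forall s, m <= F1 s) ->
  exists2 G : R -> R, cancel F G & cancel G F.
Proof.
move=> m0 DF mF.
have cF (A : set R) : {within A, continuous F}.
  apply: continuous_subspaceT => s; apply: differentiable_continuous.
  exact/derivable1_diffP/ex_derive.
have grow s t : s <= t -> m * (t - s) <= F t - F s.
  move=> st; have [c _ ->] := MVT_segment st (fun c _ => DF c) (cF _).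
  by rewrite ler_wpM2r ?subr_ge0.
have Finj : injective F.
  move=> s t; wlog st : s t / s <= t => [th Fst|Fst].
    by have [/th/(_ Fst)//|/ltW/th/(_ (esym Fst))//] := leP s t.
  have := grow _ _ st; rewrite Fst subrr pmulr_rle0// subr_le0 => ts.
  by apply/le_anti; rewrite st ts.
have surj y : exists s, F s = y.
  pose b := `|y - F 0| / m.
  have b0 : 0 <= b by rewrite divr_ge0// ltW.
  have mb : m * b = `|y - F 0| by rewrite mulrC divfK// gt_eqF.
  have nb0 : - b <= 0 by rewrite oppr_le0.
  have Fb := grow _ _ b0; have Fnb := grow _ _ nb0.
  have yb := ler_norm (y - F 0); have yb' := ler_norm (- (y - F 0)).
  rewrite normrN in yb'.
  (* The growth of F puts y between its values at - b and b. *)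
  have [||c _ <-] := @IVT R F (- b) b y _ (cF _); last by exists c.
    by rewrite (le_trans nb0).
  have l1 : F (- b) <= y by move: Fnb; rewrite sub0r opprK mb; lra.
  have l2 : y <= F b by move: Fb; rewrite subr0 mb; lra.
  by rewrite ge_min le_max l1 l2 orbT.
have [G GK] := choice surj.
by exists G => // s; apply: Finj; rewrite GK.
Qed.

Lemma is_derive_cancel (R : realType) (F F1 G : R -> R) (t : R) :
  (forall s : R, is_derive s 1 F (F1 s)) -> (forall s, F1 s != 0) ->
  cancel F G -> cancel G F -> is_derive t 1 G (F1 (G t))^-1.
Proof.
move=> DF F1n0 FK GK; rewrite -{1}(GK t).
apply: is_derive_inverse => //.
- by near do exact: FK.
- near do (apply: differentiable_continuous; exact/derivable1_diffP/ex_derive).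
Unshelve. all: by end_near. Qed.

(** As the derivative of [G] is [1 / (F1 o G)], that of [h o G] is
    [(h' / F1) o G], again of the same form. This yields the smoothness of the
    geodesics without the formula for higher derivatives of a composite. *)
Lemma trig_comp_stable (R : realType) (F1 G : R -> R) :
  trig F1 -> (forall s, F1 s != 0) ->
  (forall t : R, is_derive t 1 G (F1 (G t))^-1) ->
  derivation_stable [set f | exists2 h, trig h & f = h \o G].
Proof.
move=> tF1 F1n0 DG _ [h th ->].
have Dh (t : R) : is_derive t 1 (h \o G) ((F1 (G t))^-1 * derive1 h (G t)).
  apply: is_derive_chain; rewrite derive1E; apply: derivableP.
  exact: trig_derivable.
split=> [t|v]; first exact/derivable1_diffP/ex_derive.
exists (fun s => v * ((F1 s)^-1 * derive1 h s)).
  apply: gen_mul; first exact: gen_cst.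
  by apply: gen_mul; [exact: gen_inv|exact: trig_derive1].
apply/funext => t /=; rewrite derive_line; last exact: ex_derive.
by rewrite derive1E derive_val.
Qed.

(** The vector [F1 h2 - F2 h1] is [F' h'' - F'' h']. That it is radial is the area
    law: the derivative of [(h x h') / F'] vanishes, so that [h x h'] is [F']
    times a constant vector. Divided by [F' ^ 3], it is the acceleration of
    [h o F^-1] at the corresponding point. *)
Lemma area_law_geodesic (R : realType) (p m : R) (h h1 h2 : R -> 'rV[R]_3)
    (F F1 F2 : R -> R) :
  p != 0 -> 0 < m -> (forall s, m <= F1 s) ->
  (forall i, trig (fun s => h s 0 i)) -> trig F1 ->
  (forall s : R, is_derive s 1 h (h1 s)) ->
  (forall s : R, is_derive s 1 h1 (h2 s)) ->
  (forall s : R, is_derive s 1 F (F1 s)) ->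
  (forall s : R, is_derive s 1 F1 (F2 s)) ->
  (forall s, parabolic_sphere p (h s)) -> (forall s, h1 s != 0) ->
  (forall s, exists k, F1 s *: h2 s - F2 s *: h1 s = k *: h s) ->
  exists g : R -> 'rV[R]_3,
    [/\ r_geodesic (parabolic_sphere p) setT g, regular_on setT g,
        smooth_on setT g & range g = range h].
Proof.
move=> p0 m0 mF1 th tF1 Dh Dh1 DF DF1 hS h1n0 area.
have F1n0 s : F1 s != 0 by rewrite gt_eqF// (lt_le_trans m0).
have [G FK GK] := growth_bijective m0 DF mF1.
have DG t := is_derive_cancel t DF F1n0 FK GK.
pose g t := h (G t).
pose k1 s := (F1 s)^-1 *: h1 s.
have Dg (t : R) : is_derive t 1 g (k1 (G t)) by exact: is_derive_chain.
have g1E : derive1 g = fun t => k1 (G t).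
  by apply/funext => t; rewrite derive1E derive_val.
have Dk1 (s : R) : is_derive s 1 k1
    ((F1 s)^-1 *: h2 s - ((F1 s) ^- 2 * F2 s) *: h1 s).
  apply: is_derive_row => i.
  have -> : (fun u => k1 u 0 i) = (fun u => (F1 u)^-1) * (fun u => h1 u 0 i).
    by apply/funext => u; rewrite mxE.
  have D1 : is_derive s 1 (fun u => h1 u 0 i) (h2 s 0 i).
    have -> : h2 s = derive1 h1 s by rewrite derive1E derive_val.
    by apply: is_derive_curve; exact: ex_derive.
  have DV : is_derive s 1 (fun u => (F1 u)^-1) (- (F1 s) ^- 2 *: F2 s).
    apply: DeriveDef; first exact: derivableV.
    by rewrite deriveV// derive_val.
  apply: (is_derive_eq (is_deriveM DV D1)).
  by rewrite !mxE /GRing.scale/= /GRing.inv/=; ring.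
have Dg1 (t : R) : is_derive t 1 (derive1 g) ((F1 (G t))^-1 *:
    ((F1 (G t))^-1 *: h2 (G t) - ((F1 (G t)) ^- 2 * F2 (G t)) *: h1 (G t))).
  by rewrite g1E; exact: is_derive_chain.
exists g; split.
- split=> [| | t _|t _|t _].
  + exact: openT.
  + by [].
  + exact: hS.
  + by split; exact: ex_derive.
  + exists (p^-1 *: g t).
    have [k] := area (G t); rewrite -/(g t) => kE.
    exists ((F1 (G t)) ^- 3 * k * p); split.
      exact: (proj2 (gauss_at_sphere _ p0 (hS _))).
    rewrite /= [LHS]derive1E derive_val scalerA mulfK//.
    rewrite -[(_ * k) *: _]scalerA -kE.
    apply/rowP => i; rewrite !mxE; field; exact: F1n0.
- by move=> t _; rewrite g1E scaler_eq0 invr_eq0 negb_or F1n0 h1n0.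
- apply: (smooth_on_row (trig_comp_stable tF1 F1n0 DG)) => i.
  by exists (fun s => h s 0 i).
- apply/seteqP; split=> _ [t _ <-]; first by exists (G t).
  by exists (F t); rewrite // /g FK.
Qed.

(** * Central plane sections *)

Lemma is_derive_vec3 (R : realType) (a b c : R -> R) (s da db dc : R) :
  is_derive s 1 a da -> is_derive s 1 b db -> is_derive s 1 c dc ->
  is_derive s 1 (fun t => vec3 (a t) (b t) (c t)) (vec3 da db dc).
Proof.
move=> Da Db Dc; apply: is_derive_row; apply: ord3P; rewrite !vec3E.
- by rewrite (_ : (fun _ => _) = a)//; apply/funext => t; rewrite vec3E.
- by rewrite (_ : (fun _ => _) = b)//; apply/funext => t; rewrite vec3E.
- by rewrite (_ : (fun _ => _) = c)//; apply/funext => t; rewrite vec3E.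
Qed.

Lemma trig_vec3 (R : realType) (a b c : R -> R) :
  trig a -> trig b -> trig c ->
  forall i, trig (fun t => vec3 (a t) (b t) (c t) 0 i).
Proof.
move=> ta tb tc; apply: ord3P.
- by rewrite (_ : (fun _ => _) = a)//; apply/funext => t; rewrite vec3E.
- by rewrite (_ : (fun _ => _) = b)//; apply/funext => t; rewrite vec3E.
- by rewrite (_ : (fun _ => _) = c)//; apply/funext => t; rewrite vec3E.
Qed.

Lemma trig_scale (R : realType) (c : R) (f : R -> R) :
  trig f -> trig (fun s => c * f s).
Proof. by move=> tf; apply: gen_mul => //; exact: gen_cst. Qed.

Lemma is_derive_scale (R : realType) (c s d : R) (f : R -> R) :
  is_derive s 1 f d -> is_derive s 1 (fun t => c * f t) (c * d).
Proof.
move=> Df; apply: (is_derive_eq (is_deriveM (is_derive_cst c s 1) Df)).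
by rewrite /GRing.scale/=; ring.
Qed.

Lemma is_derive_translate (R : realType) (c s d : R) (f : R -> R) :
  is_derive s 1 f d -> is_derive s 1 (fun t => c + f t) d.
Proof.
move=> Df; apply: (is_derive_eq (is_deriveD (is_derive_cst c s 1) Df)).
by rewrite add0r.
Qed.

Lemma vec3_eq (R : realType) (q : 'rV[R]_3) (a b c : R) :
  a = q 0 0 -> b = q 0 1 -> c = q 0 2 -> vec3 a b c = q.
Proof. by move=> -> -> ->; apply/rowP; apply: ord3P; rewrite vec3E. Qed.

(** In the plane [a x + b y = 0] the section is the parabola
    [h s = (- b s, a s, p / 2 - q s ^ 2 / (2 p))] with [q = a ^ 2 + b ^ 2]. It
    sweeps area at the rate [|h x h'|], proportional to [p ^ 2 + q s ^ 2]. *)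
Lemma isotropic_section (R : realType) (p : R) (n : 'rV[R]_3) :
  p != 0 -> n != 0 -> n 0 2 = 0 ->
  exists g : R -> 'rV[R]_3,
    [/\ r_geodesic (parabolic_sphere p) setT g, regular_on setT g,
        smooth_on setT g &
        range g = parabolic_sphere p `&` plane_through 0 n].
Proof.
move=> p0 nn0 n2; set a := n 0 0; set b := n 0 1.
have ab0 : (a != 0) || (b != 0).
  rewrite -negb_and; apply: contra nn0 => /andP[/eqP a0 /eqP b0].
  by apply/eqP/rowP; apply: ord3P; rewrite mxE.
pose q := a ^+ 2 + b ^+ 2.
have q0 : 0 < q.
  by case/orP: ab0 => ?; [apply: ltr_pwDl|apply: ltr_wpDl];
    rewrite ?sqr_ge0// exprn_even_gt0.
have p20 : 0 < p ^+ 2 by rewrite exprn_even_gt0.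
pose h (s : R) := vec3 (- b * s) (a * s) (p / 2 - q / (2 * p) * (s * s)).
pose h1 (s : R) := vec3 (- b) a (- (q / p) * s).
pose h2 (s : R) := vec3 0 0 (- (q / p)).
pose F (s : R) := p ^+ 2 * s + q / 3 * (s * s * s).
pose F1 (s : R) := p ^+ 2 + q * (s * s).
pose F2 (s : R) := 2 * q * s.
have lin (c s : R) : is_derive s 1 (fun t => c * t) c.
  apply: (is_derive_eq (is_deriveM (is_derive_cst c s 1) (is_derive_id s 1))).
  by rewrite /GRing.scale/=; ring.
have sq (s : R) : is_derive s 1 (fun t => t * t) (2 * s).
  apply: (is_derive_eq (is_deriveM (is_derive_id s 1) (is_derive_id s 1))).
  by rewrite /GRing.scale/=; ring.
have tsq : trig (fun s : R => s * s) by apply: gen_mul; exact: trig_id.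
have hS s : parabolic_sphere p (h s).
  by rewrite /parabolic_sphere/= /h !vec3E /q; field.
have [||||||||||g [geo reg sm gE]] :=
    @area_law_geodesic R p (p ^+ 2) h h1 h2 F F1 F2 p0 p20.
- by move=> s; rewrite /F1 lerDl mulr_ge0 ?(ltW q0)// -expr2 sqr_ge0.
- apply: trig_vec3; [exact/trig_scale/trig_id|exact/trig_scale/trig_id|].
  apply: gen_add; first exact: gen_cst.
  by apply: gen_opp; exact: trig_scale.
- by apply: gen_add; [exact: gen_cst|exact: trig_scale].
- move=> s; apply: is_derive_vec3.
  apply: (is_derive_eq (is_deriveB (is_derive_cst _ _ _)
    (is_derive_scale _ (sq s)))).
  by field.
- by move=> s; apply: is_derive_vec3.
- move=> s.
  apply: (is_derive_eq (is_deriveD (lin _ s)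
    (is_derive_scale _ (is_deriveM (sq s) (is_derive_id s 1))))).
  by rewrite /F1 /GRing.scale/=; field.
- move=> s.
  apply: (is_derive_eq (is_deriveD (is_derive_cst _ _ _)
    (is_derive_scale _ (sq s)))).
  by rewrite /F2; ring.
- exact: hS.
- move=> s; apply/eqP => /rowP h10.
  have := h10 0; have := h10 1; rewrite !mxE/= => a0 /eqP.
  by move: ab0; rewrite oppr_eq0 a0 eqxx/= => /negbTE ->.
- move=> s; exists (- 2 * q).
  by apply/rowP; apply: ord3P; rewrite !mxE/= /F1 /F2; field.
exists g; split=> //; rewrite gE; apply/seteqP; split=> [_ [s _ <-]|u [Su Pu]].
  split; first exact: hS.
  by apply/plane_through0; rewrite /h !vec3E n2 -/a -/b; ring.
move/plane_through0 : Pu; rewrite n2 -/a -/b mul0r addr0 => Pu.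
(* The parameter of a point of the section is its coordinate along (- b, a). *)
have x_eq : - b * (- b * u 0 0 + a * u 0 1) / q = u 0 0.
  transitivity (u 0 0 - a * (a * u 0 0 + b * u 0 1) / q).
    by rewrite /q; field; rewrite -/q gt_eqF.
  by rewrite Pu; ring.
have y_eq : a * (- b * u 0 0 + a * u 0 1) / q = u 0 1.
  transitivity (u 0 1 - b * (a * u 0 0 + b * u 0 1) / q).
    by rewrite /q; field; rewrite -/q gt_eqF.
  by rewrite Pu; ring.
exists ((- b * u 0 0 + a * u 0 1) / q) => //; apply: vec3_eq.
- by rewrite mulrA.
- by rewrite mulrA.
- by rewrite Su -[in RHS]x_eq -[in X in _ = _ - _ * (_ + X ^+ 2)]y_eq /q; field;
    rewrite -/q gt_eqF.
Qed.

Lemma circle_angle (R : realType) (c s : R) :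
  c ^+ 2 + s ^+ 2 = 1 -> exists t : R, cos t = c /\ sin t = s.
Proof.
move=> cs1.
have s2 := sqr_ge0 s.
have c1 : -1 <= c <= 1 by apply/andP; split; nra.
have ct : cos (acos c) = c by rewrite acosK.
have st : sin (acos c) = `|s|.
  by rewrite sin_acos// -sqrtr_sqr -cs1; congr Num.sqrt; ring.
have [s0|s0] := leP 0 s.
  by exists (acos c); split=> //; rewrite st ger0_norm.
by exists (- acos c); rewrite cosN sinN ct st ltr0_norm// opprK.
Qed.

(** Twice the difference of the two sides is [(r + A) ^ 2 + B ^ 2]. This bounds
    below the rate at which area is swept about a point inside a circle. *)
Lemma kepler_rate_ge (R : realType) (r A B : R) :
  A ^+ 2 + B ^+ 2 = r ^+ 2 - 1 -> 2^-1 <= r ^+ 2 + r * A.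
Proof. by have := sqr_ge0 (r + A); have := sqr_ge0 B; nra. Qed.

(** In the plane [z = - (a x + b y)] the section projects onto the circle with
    centre [p (a, b)] and radius [|p| r], where [r ^ 2 = 1 + a ^ 2 + b ^ 2], so
    that the origin lies inside the circle. Up to the factor [p ^ 2], the area
    swept about the origin at the angle [t] grows at the rate
    [r ^ 2 + r (a cos t + b sin t)], which is positive; its primitive [F] has
    the form of Kepler's equation. *)
Lemma nonisotropic_section (R : realType) (p : R) (n : 'rV[R]_3) :
  p != 0 -> n 0 2 != 0 ->
  exists g : R -> 'rV[R]_3,
    [/\ r_geodesic (parabolic_sphere p) setT g, regular_on setT g,
        smooth_on setT g &
        range g = parabolic_sphere p `&` plane_through 0 n].
Proof.
move=> p0 n2; pose a := n 0 0 / n 0 2; pose b := n 0 1 / n 0 2.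
pose r := Num.sqrt (1 + (a ^+ 2 + b ^+ 2)).
have ab0 : 0 <= a ^+ 2 + b ^+ 2 by rewrite addr_ge0 ?sqr_ge0.
have r2 : r ^+ 2 = 1 + (a ^+ 2 + b ^+ 2) by rewrite sqr_sqrtr// addr_ge0.
have r0 : r != 0 by rewrite -sqrf_eq0 r2 gt_eqF// ltr_pwDl.
pose x t := p * a + p * r * cos t.
pose y t := p * b + p * r * sin t.
pose h (t : R) := vec3 (x t) (y t) (- a * x t + - b * y t).
pose h1 (t : R) := vec3 (p * r * - sin t) (p * r * cos t)
  (- a * (p * r * - sin t) + - b * (p * r * cos t)).
pose h2 (t : R) := vec3 (p * r * - cos t) (p * r * - sin t)
  (- a * (p * r * - cos t) + - b * (p * r * - sin t)).
pose F (t : R) := r ^+ 2 * t + (r * a * sin t + r * - b * cos t).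
pose F1 (t : R) := r ^+ 2 + (r * a * cos t + r * b * sin t).
pose F2 (t : R) := r * a * - sin t + r * b * cos t.
have tx : trig x.
  by apply: gen_add; [exact: gen_cst|exact/trig_scale/trig_cos].
have ty : trig y.
  by apply: gen_add; [exact: gen_cst|exact/trig_scale/trig_sin].
have cs t := cos2Dsin2 (t : R).
have h_sphere t : parabolic_sphere p (h t).
  rewrite /parabolic_sphere/= /h !vec3E.
  transitivity (p / 2 - (2 * p)^-1 * (x t ^+ 2 + y t ^+ 2) +
      p / 2 * ((r ^+ 2 - (1 + (a ^+ 2 + b ^+ 2)))
        + r ^+ 2 * (cos t ^+ 2 + sin t ^+ 2 - 1))).
    by rewrite /x /y; field.
  by rewrite r2 cs !subrr mulr0 addr0 mulr0 addr0.
have half_gt0 : 0 < 2^-1 :> R by rewrite invr_gt0.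
have [||||||||||g [geo reg sm gE]] :=
    @area_law_geodesic R p 2^-1 h h1 h2 F F1 F2 p0 half_gt0.
- move=> t; rewrite /F1.
  rewrite (_ : r * a * cos t + _ = r * (a * cos t + b * sin t)); last by ring.
  apply: (kepler_rate_ge (B := a * sin t - b * cos t)).
  transitivity ((a ^+ 2 + b ^+ 2) * (cos t ^+ 2 + sin t ^+ 2)); first by ring.
  by rewrite cs r2; ring.
- by apply: trig_vec3 => //; apply: gen_add; exact: trig_scale.
- apply: gen_add; first exact: gen_cst.
  by apply: gen_add; [exact/trig_scale/trig_cos|exact/trig_scale/trig_sin].
- move=> t.
  have Dx : is_derive t 1 x (p * r * - sin t).
    exact: (is_derive_translate _ (is_derive_scale _ (is_derive_cos t))).
  have Dy : is_derive t 1 y (p * r * cos t).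
    exact: (is_derive_translate _ (is_derive_scale _ (is_derive_sin t))).
  exact: (is_derive_vec3 Dx Dy
    (is_deriveD (is_derive_scale _ Dx) (is_derive_scale _ Dy))).
- move=> t.
  have Dx : is_derive t 1 (fun t => p * r * - sin t) (p * r * - cos t).
    exact: (is_derive_scale _ (is_deriveN (is_derive_sin t))).
  have Dy : is_derive t 1 (fun t => p * r * cos t) (p * r * - sin t).
    exact: (is_derive_scale _ (is_derive_cos t)).
  exact: (is_derive_vec3 Dx Dy
    (is_deriveD (is_derive_scale _ Dx) (is_derive_scale _ Dy))).
- move=> t.
  apply: (is_derive_eq (is_deriveD (is_derive_scale _ (is_derive_id t 1))
    (is_deriveD (is_derive_scale _ (is_derive_sin t))
      (is_derive_scale _ (is_derive_cos t))))).
  by rewrite /F1; ring.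
- move=> t.
  exact: (is_derive_translate _
    (is_deriveD (is_derive_scale _ (is_derive_cos t))
      (is_derive_scale _ (is_derive_sin t)))).
- exact: h_sphere.
- move=> t; apply/eqP => /rowP h10.
  have := h10 0; have := h10 1; rewrite !mxE/= => /eqP + /eqP.
  rewrite !mulf_eq0 oppr_eq0 (negbTE p0) (negbTE r0)/= => /eqP c0 /eqP s0.
  by have /eqP := cs t; rewrite c0 s0 expr0n/= addr0 eq_sym oner_eq0.
- move=> t; exists (- r ^+ 2).
  have X : F1 t * (p * r * - cos t) - F2 t * (p * r * - sin t) = - r ^+ 2 * x t.
    transitivity (- r ^+ 2 * (p * a * (cos t ^+ 2 + sin t ^+ 2)
      + p * r * cos t)); first by rewrite /F1 /F2; ring.
    by rewrite cs /x; ring.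
  have Y : F1 t * (p * r * - sin t) - F2 t * (p * r * cos t) = - r ^+ 2 * y t.
    transitivity (- r ^+ 2 * (p * b * (cos t ^+ 2 + sin t ^+ 2)
      + p * r * sin t)); first by rewrite /F1 /F2; ring.
    by rewrite cs /y; ring.
  apply/rowP; apply: ord3P; rewrite !mxE//=.
  transitivity (- a * (F1 t * (p * r * - cos t) - F2 t * (p * r * - sin t))
    + - b * (F1 t * (p * r * - sin t) - F2 t * (p * r * cos t))).
    by ring.
  by rewrite X Y; ring.
have planeE (u : 'rV[R]_3) :
    plane_through 0 n u <-> u 0 2 = - a * u 0 0 + - b * u 0 1.
  have E : n 0 0 * u 0 0 + n 0 1 * u 0 1 + n 0 2 * u 0 2 =
      n 0 2 * (u 0 2 - (- a * u 0 0 + - b * u 0 1)).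
    by rewrite /a /b; field.
  split=> [/plane_through0/eqP|u2].
    by rewrite E mulf_eq0 (negbTE n2) subr_eq0 => /eqP.
  by apply/plane_through0; rewrite E u2 subrr mulr0.
exists g; split=> //; rewrite gE; apply/seteqP; split=> [_ [t _ <-]|u [Su Pu]].
  by split; [exact: h_sphere|apply/planeE; rewrite /h !vec3E].
move/planeE : Pu => u2.
have [|t [ct st]] :=
    @circle_angle R ((u 0 0 / p - a) / r) ((u 0 1 / p - b) / r).
  rewrite !expr_div_n -mulrDl r2.
  apply: (canLR (mulfK _)); first by rewrite gt_eqF// ltr_pwDl.
  have : p * u 0 2 *+ 2 = p ^+ 2 - (u 0 0 ^+ 2 + u 0 1 ^+ 2).
    by rewrite Su; field.
  rewrite u2 => E.
  transitivity (1 + (a ^+ 2 + b ^+ 2) + p ^- 2 *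
    (p * (- a * u 0 0 + - b * u 0 1) *+ 2
      - (p ^+ 2 - (u 0 0 ^+ 2 + u 0 1 ^+ 2)))).
    by field.
  by rewrite E; ring.
have xt : x t = u 0 0 by rewrite /x ct; field; rewrite p0 r0.
have yt : y t = u 0 1 by rewrite /y st; field; rewrite p0 r0.
by exists t => //; apply: vec3_eq => //; rewrite xt yt u2.
Qed.

Theorem mainTheorem10 (R : realType) (p : R) (hp : p != 0) :
  (forall (I : set R) (g : R -> 'rV[R]_3),
      r_geodesic (parabolic_sphere p) I g -> regular_on I g ->
      exists2 n : 'rV[R]_3, n != 0 &
        g @` I `<=` parabolic_sphere p `&` plane_through 0 n) /\
  (forall n : 'rV[R]_3, n != 0 ->
      exists (I : set R) (g : R -> 'rV[R]_3),
        [/\ r_geodesic (parabolic_sphere p) I g,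
            regular_on I g,
            smooth_on I g &
            g @` I = parabolic_sphere p `&` plane_through 0 n]).
Proof.
split=> [I g|n n0]; first exact: geodesic_in_plane.
exists setT; have [n2|n2] := eqVneq (n 0 2) 0.
  exact: isotropic_section.
exact: nonisotropic_section.
Qed.
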